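(* Let $\pi=\{p_1,\ldots,p_n\}$ be a finite set of primes and let $G$ be a finite group. Suppose that $G$ has three $\pi$-soluble subgroups $A_1,A_2,A_3$ whose indices $|G:A_1|,|G:A_2|,|G:A_3|$ are pairwise coprime and each of them is either a $\pi$-number or a $\pi'$-number. Suppose also that at most one of the numbers $|G:A_1|,|G:A_2|,|G:A_3|$ is a $\pi'$-number. Then $G$ is $\pi$-soluble.
   Context: All groups are finite. $\pi'$ is the set of primes not in $\pi$. A $\pi$-number (respectively $\pi'$-number) is a positive integer all of whose prime divisors lie in $\pi$ (respectively $\pi'$). A group is $\pi$-soluble if each of its chief factors is either a $p$-group for some $p\in\pi$ or a $\pi'$-group. *)

(* Defs.v *)
From mathcomp Require Import all_boot all_fingroup all_solvable.

Set Implicit Arguments.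
Unset Strict Implicit.
Unset Printing Implicit Defensive.

Local Open Scope group_scope.

(* In [chief_factor G K H], K is the lower and H the upper term of H / K.     *)
Definition pi_soluble (gT : finGroupType) (pi : nat_pred) (G : {group gT}) :
    Prop :=
  forall H K : {group gT}, chief_factor G K H ->
    (exists2 p : nat, p \in pi & p.-group (H / K)) \/ pi^'.-group (H / K).

(* Main.v *)
Require Import Defs.
From mathcomp Require Import all_boot all_fingroup all_solvable.

Set Implicit Arguments.
Unset Strict Implicit.
Unset Printing Implicit Defensive.

Local Open Scope group_scope.

(** Wielandt's argument. Let [A], [B], [C] be pi-soluble of pairwise coprime
    indices, [B] of pi-index. For sigma a single prime of pi, or pi^', a
    nontrivial normal sigma-subgroup [M] of [A] lies in every subgroup [D] of
    sigma^'-index coprime to [#|G : A|], because [#|M : M :&: D|] divides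
    [#|G : D|]. One of [B] and [C] is such a [D]: if sigma is one prime, it
    divides at most one of their indices, and if sigma is pi^', then [B] works.
    As [G = D * A] and [A] normalises [M], all [D :^ g] contain [M], so the core
    of [D] in [G] is a nontrivial normal subgroup lying in a pi-soluble group;
    conclude by induction on [#|G|]. *)

(** One predicate [sigma] covers both kinds of chief factor, so that each is simply a [sigma]-group;
    in the first case [p] is coerced to the singleton predicate. *)
Definition admissible (pi sigma : nat_pred) : Prop :=
  (exists2 p : nat, p \in pi & sigma = p) \/ sigma = pi^'.

(** A normal subgroup [M] of [G], minimal among those strictly above [U], makes [M / U] a chief
    factor; starting the descent from [V] keeps [M] inside [V]. *)
Lemma pi_soluble_section (gT : finGroupType) (pi : nat_pred)
    (G U V : {group gT}) :
    pi_soluble pi G -> U <| G -> V <| G -> U \proper V ->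
  exists sigma (M : {group gT}),
    [/\ admissible pi sigma, M <| G, U \proper M, M \subset V
      & sigma.-nat #|M : U|].
Proof.
move=> solG nUG nVG prUV.
pose P (X : {group gT}) := (U \proper X) && (X <| G).
have PV : P V by rewrite /P prUV.
have [M /mingroupP[/andP[prUM nMG] minM] sMV] := @mingroup_exists _ P V PV.
have chM : chief_factor G U M.
  rewrite /chief_factor nMG andbT; apply/maxgroupP.
  split=> [|W /andP[prWM nWG] sUW]; first by rewrite prUM normal_norm.
  apply/eqP; rewrite eq_sym eqEproper sUW /=; apply/negP => prUW.
  have nWGn : W <| G.
    by rewrite /normal nWG (subset_trans (proper_sub prWM) (normal_sub nMG)).
  have PW : P W by rewrite /P prUW.
  by have:= prWM; rewrite (minM W PW (proper_sub prWM)) properxx.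
have nUM : M \subset 'N(U).
  exact: subset_trans (normal_sub nMG) (normal_norm nUG).
have idx : #|M : U| = #|M / U| by rewrite card_quotient.
case: (solG _ _ chM) => [[p pip pM] | pM].
  by exists p, M; split=> //; [left; exists p | rewrite idx].
by exists pi^', M; split=> //; [right | rewrite idx].
Qed.

(** Converse of [pi_soluble_section]: one admissible step above each proper normal subgroup controls
    all chief factors, so later proofs of solubility only build such steps. *)
Lemma pi_soluble_of_steps (gT : finGroupType) (pi : nat_pred)
    (G : {group gT}) :
    (forall K : {group gT}, K <| G -> K \proper G ->
      exists sigma (M : {group gT}),
      [/\ admissible pi sigma, M <| G, K \proper M & sigma.-nat #|M : K|]) ->
  pi_soluble pi G.
Proof.
move=> stepG H K /andP[/maxgroupP[/andP[prKH nKG] maxK] nHG].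
have nKGn : K <| G.
  by rewrite /normal nKG (subset_trans (proper_sub prKH) (normal_sub nHG)).
(* For [L] maximal among the normal subgroups with [L :&: H = K], the next step
   above [L] must contain [H], so H / K embeds in it. *)
pose P (X : {group gT}) := (X <| G) && (X :&: H == K).
have PK : P K by rewrite /P nKGn (setIidPl (proper_sub prKH)) eqxx.
have [L /maxgroupP[/andP[nLG /eqP LH] maxL] sKL] := @maxgroup_exists _ P K PK.
have prLG : L \proper G.
  rewrite properEneq normal_sub // andbT; apply/eqP => eLG.
  move: prKH; rewrite -LH eLG (setIidPr (normal_sub nHG)) properxx //.
have [sigma [M [adm nMG prLM sM]]] := stepG L nLG prLG.
have sHM : H \subset M.
  apply/setIidPr/eqP; rewrite eqEproper subsetIr /=; apply/negP => prMH.
  have sKMH : K \subset M :&: H.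
    by rewrite subsetI (subset_trans sKL (proper_sub prLM)) proper_sub.
  have eqK : M :&: H = K.
    by apply: (maxK [group of M :&: H]) => //; rewrite prMH normsI ?normal_norm.
  have PM : P M by rewrite /P nMG eqK eqxx.
  by have:= prLM; rewrite properE (maxL M PM (proper_sub prLM)) subxx.
have sHK : sigma.-group (H / K).
  rewrite /pgroup card_quotient; last first.
    exact: subset_trans (normal_sub nHG) nKG.
  have nLM : M \subset 'N(L).
    exact: subset_trans (normal_sub nMG) (normal_norm nLG).
  rewrite -LH setIC indexgI -card_quotient ?(subset_trans sHM) //.
  apply: (@pgroupS _ _ (M / L)); first exact: quotientS.
  by rewrite /pgroup card_quotient.
case: adm sHK => [[p pip ->] | ->] sHK; last by right.
by left; exists p.
Qed.

Lemma morphim_pi_soluble (aT rT : finGroupType) (pi : nat_pred)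
    (D : {group aT}) (f : {morphism D >-> rT}) (G : {group aT}) :
  G \subset D -> pi_soluble pi G -> pi_soluble pi (f @* G)%G.
Proof.
move=> sGD solG; apply: pi_soluble_of_steps => K nKfG prKfG.
(* A step [M] above the preimage [K0] maps to a step above [K]: were [f @* M] inside [K], then [M]
   would lie in [K0]. *)
pose K0 := [group of G :&: f @*^-1 K].
have fK0 : f @* K0 = K.
  by rewrite morphimIG ?ker_sub_pre // morphpreK ?(setIidPr (normal_sub nKfG)) //
     (subset_trans (normal_sub nKfG)) ?morphimS // morphim_sub.
have nK0 : K0 <| G.
  rewrite /normal subsetIl normsI ?normG //.
  apply: subset_trans (morphpre_norm _ _).
  by rewrite -sub_morphim_pre // normal_norm.
have prK0 : K0 \proper G.
  rewrite properEneq subsetIl andbT; apply/eqP => eK0.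
  by move: prKfG; rewrite /= -fK0 eK0 properxx.
have [sigma [M [adm nMG prK0M _ sM]]] :=
  pi_soluble_section solG nK0 (normal_refl G) prK0.
exists sigma, (f @* M)%G; split=> //; first exact: morphim_normal.
  apply/andP; split; first by rewrite -fK0 morphimS ?proper_sub.
  apply/negP => sfMK.
  have sMD := subset_trans (normal_sub nMG) sGD.
  have:= prK0M; rewrite properE => /andP[_ /negP[]].
  by rewrite subsetI (normal_sub nMG) -sub_morphim_pre //.
rewrite -fK0; apply: pnat_dvd sM; apply: index_morphim.
exact: subset_trans (subset_trans (subsetIl _ _) (normal_sub nMG)) sGD.
Qed.

(** Above [K] containing [N], a step lifts from [G / N]. Otherwise the solubility of [A] yields a
    step inside [N] above [N :&: K], to be made normal in [G]. *)
Lemma pi_soluble_extension (gT : finGroupType) (pi : nat_pred)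
    (G A N : {group gT}) :
    N <| G -> N \subset A -> A \subset G ->
    pi_soluble pi A -> pi_soluble pi (G / N)%G ->
  pi_soluble pi G.
Proof.
move=> nNG sNA sAG solA solGN; apply: pi_soluble_of_steps => K nKG prKG.
have [sNK | nsNK] := boolP (N \subset K).
  have prKGN : K / N \proper G / N.
    by rewrite quotient_proper // (normalS sNK (normal_sub nKG)).
  have nNK : N <| K := normalS sNK (normal_sub nKG) nNG.
  have [sigma [M [adm nMG prKM _ sM]]] :=
    pi_soluble_section solGN (quotient_normal N nKG) (normal_refl _) prKGN.
  have [M0 eM sNM0 sM0G] := inv_quotientS nNG (normal_sub nMG).
  have nNM0 : N <| M0 := normalS sNM0 sM0G nNG.
  have nM0G : M0 <| G.
    by rewrite -(quotientGK nNM0) -(quotientGK nNG) -eM cosetpre_normal.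
  have prKM0 : K \proper M0 by move: prKM; rewrite eM quotient_proper.
  exists sigma, M0; split=> //.
  move: sM; rewrite eM /= index_quotient_eq ?(proper_sub prKM0) //.
    by rewrite subIset // sNK orbT.
  exact: subset_trans sM0G (normal_norm nNG).
have prI : N :&: K \proper N by rewrite properE subsetIl subsetI subxx.
have nIA : N :&: K <| A.
  by apply: normalS sAG (normalI nNG nKG); rewrite subIset ?sNA.
have [sigma [L [adm nLA prIL sLN sL]]] :=
  pi_soluble_section (U := [group of N :&: K]) solA nIA
    (normalS sNA sAG nNG) prI.
have nKL : L \subset 'N(K).
  exact: subset_trans (subset_trans sLN (normal_sub nNG)) (normal_norm nKG).
have LK : L :&: K = N :&: K.
  apply/eqP; rewrite eqEsubset setSI //= subsetI subsetIr andbT.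
  exact: proper_sub prIL.
have sgL : sigma.-group (L / K).
  by rewrite /pgroup card_quotient // -indexgI LK.
(* [L] is known to be normal only in [A], but this puts [L / K] in ['O_sigma(N / K)], which is
   characteristic in [N / K], hence normal in [G / K]. The step sought is the preimage of
   ['O_sigma(G / K)]. *)
have sLO : L / K \subset 'O_sigma(G / K).
  apply: (@subset_trans _ _ (mem 'O_sigma(N / K))).
    by apply: pcore_max => //; apply: quotient_normal; apply: normalS nLA.
  by apply: pcore_max (pcore_pgroup _ _) _; apply: gFnormal_trans;
     apply: quotient_normal.
have [M eM sKM sMG] := inv_quotientS nKG (pcore_sub sigma (G / K)).
have nKM : K <| M := normalS sKM sMG nKG.
exists sigma, M; split=> //.
- by rewrite -(quotientGK nKM) -(quotientGK nKG) cosetpre_normal -eM pcore_normal.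
- rewrite properE sKM; apply/negP => sMK.
  move: prIL; rewrite properE => /andP[_ /negP[]].
  rewrite subsetI sLN -quotient_sub1 //.
  by rewrite (subset_trans sLO) // eM quotient_sub1 ?normal_norm.
by rewrite -card_quotient ?normal_norm // -eM; apply: pcore_pgroup.
Qed.

Lemma normal_pgroup_sub_gcore (gT : finGroupType) (sigma : nat_pred)
    (G A D M : {group gT}) :
    A \subset G -> D \subset G -> coprime #|G : D| #|G : A| ->
    M <| A -> sigma.-group M -> sigma^'.-nat #|G : D| ->
  M \subset gcore D G.
Proof.
move=> sAG sDG co nMA sM s'D.
have defG : D * A = G := coprime_index_mulG sDG sAG co.
have sEA : (A :&: D) <*> M \subset A by rewrite join_subG subsetIl normal_sub.
have nME : A :&: D \subset 'N(M).
  exact: subset_trans (subsetIl _ _) (normal_norm nMA).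
(* As [G = D * A], [#|G : D|] equals [#|A : A :&: D|]; in the chain from [A :&: D] through
   [(A :&: D) <*> M] to [A], the lower index is [#|M : M :&: D|]. *)
have iMD : #|M : D| %| #|G : D|.
  rewrite -defG indexMg -(indexgI A) -(Lagrange_index sEA (joing_subl _ _)) /=.
  rewrite norm_joinEl // indexMg -(indexgI _ [group of A :&: D]) /= setIA.
  by rewrite (setIidPl (normal_sub nMA)) indexgI dvdn_mull.
have sMD : M \subset D.
  rewrite -indexg_eq1; apply/eqP; apply: (@pnat_1 sigma).
    exact: pnat_dvd (dvdn_indexg _ _) sM.
  exact: pnat_dvd iMD s'D.
apply/bigcapsP => g; rewrite -{1}defG => /mulsgP[d a Dd Aa ->].
by rewrite conjsgM conjGid // -(normsP (normal_norm nMA) a Aa) conjSg.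
Qed.

Lemma pi_soluble_three_subgroups (pi : nat_pred) (gT : finGroupType)
    (G A B C : {group gT}) :
    A \subset G -> B \subset G -> C \subset G ->
    pi_soluble pi A -> pi_soluble pi B -> pi_soluble pi C ->
    coprime #|G : A| #|G : B| -> coprime #|G : A| #|G : C| ->
    coprime #|G : B| #|G : C| ->
    pi.-nat #|G : B| ->
  pi_soluble pi G.
Proof.
have [n] := ubnP #|G|; elim: n => // n IHn in gT G A B C *.
rewrite ltnS => leGn sAG sBG sCG solA solB solC coAB coAC coBC piB.
(* If [A] is trivial, its index [#|G|] is coprime to its own divisor [#|G : B|], which is therefore
   1. *)
have [A1 | ntA] := eqsVneq A 1.
  suff -> : G = B by [].
  apply/val_inj/eqP; rewrite eq_sym eqEsubset sBG -indexg_eq1 /=.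
  move: coAB; rewrite A1 indexg1 => coGB.
  by have := coprime_dvdl (dvdn_indexg G B) coGB; rewrite /coprime gcdnn.
have [sigma [M [adm nMA prM _]]] :=
  pi_soluble_section solA (normal1 A) (normal_refl A) (etrans (proper1G A) ntA).
rewrite indexg1 => sM.
(* Given [D], its core contains [M], so the quotient by the core is smaller; the indices there
   divide the original ones, which preserves all arithmetic hypotheses. *)
suff [D [sDG solD coAD s'D]] : exists D : {group gT},
    [/\ D \subset G, pi_soluble pi D, coprime #|G : A| #|G : D|
      & sigma^'.-nat #|G : D|].
  have sMN : M \subset gcore D G.
    by apply: normal_pgroup_sub_gcore nMA sM s'D; rewrite // coprime_sym.
  have nNG : gcore D G <| G := gcore_normal sDG.
  apply: (@pi_soluble_extension _ _ _ D [group of gcore D G]) => //=.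
    exact: gcore_sub.
  have nN (X : {group gT}) : X \subset G -> X \subset 'N(gcore D G).
    by move=> sXG; apply: subset_trans sXG (normal_norm nNG).
  have solQ (X : {group gT}) : X \subset G -> pi_soluble pi X ->
    pi_soluble pi (X / [group of gcore D G])%G.
    by move=> sXG; apply: morphim_pi_soluble; apply: nN.
  have dvdQ (X : {group gT}) : X \subset G ->
      #|G / gcore D G : X / gcore D G| %| #|G : X|.
    by move=> sXG; apply: index_morphim; rewrite subIset ?nN.
  apply: (IHn _ _ (A / [group of gcore D G])%G (B / [group of gcore D G])%G
                  (C / [group of gcore D G])%G); rewrite ?quotientS //=.
  - apply: leq_trans leGn; apply: ltn_quotient; last exact: normal_sub nNG.
    by rewrite -proper1G; apply: proper_sub_trans sMN.
  - exact: solQ sAG solA.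
  - exact: solQ sBG solB.
  - exact: solQ sCG solC.
  - exact: coprime_dvdl (dvdQ _ sAG) (coprime_dvdr (dvdQ _ sBG) coAB).
  - exact: coprime_dvdl (dvdQ _ sAG) (coprime_dvdr (dvdQ _ sCG) coAC).
  - exact: coprime_dvdl (dvdQ _ sBG) (coprime_dvdr (dvdQ _ sCG) coBC).
  - exact: pnat_dvd (dvdQ _ sBG) piB.
case: adm => [[p _ ->] | ->]; last by exists B; split; rewrite ?pnatNK.
have [p'B | pB] := boolP (p^'.-nat #|G : B|); first by exists B.
exists C; split=> //; rewrite p'natEpi //; apply/negP => pC.
move: pB; rewrite p'natEpi // negbK => pB.
by move: coBC; rewrite coprime_has_primes // => /hasPn/(_ p pC)/negP[].
Qed.

Theorem corollary1p16 (gT : finGroupType) (pi : nat_pred)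
    (pi_fin : exists2 ps : seq nat, all prime ps & pi =i ps)
    (G : {group gT}) (A : 'I_3 -> {group gT})
    (sAG : forall i, A i \subset G)
    (solA : forall i, pi_soluble pi (A i))
    (co_index : forall i j, i != j -> coprime #|G : A i| #|G : A j|)
    (pi_index : forall i, pi.-nat #|G : A i| \/ pi^'.-nat #|G : A i|)
    (at_most_one_pi'_index : forall i j,
       pi^'.-nat #|G : A i| -> pi^'.-nat #|G : A j| -> i = j) :
  pi_soluble pi G.
Proof.
(* Testing two of the three subgroups suffices: both indices being [pi^']-numbers would force
   [ord0 = ord_max]. *)
have [k pik] : exists k, pi.-nat #|G : A k|.
  case: (pi_index ord0) => [|pi'0]; first by exists ord0.
  case: (pi_index ord_max) => [|pi'2]; first by exists ord_max.
  by have := at_most_one_pi'_index _ _ pi'0 pi'2.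
(* The subgroup of [pi]-index takes the second place; the cyclic successor [ordS] enumerates the
   other two. *)
apply: (@pi_soluble_three_subgroups pi gT G (A (ordS k)) (A k)
          (A (ordS (ordS k)))) => //; apply: co_index;
  by case: k {pik} => [[|[|[|]]]].
Qed.
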